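(* Let $(\Omega,\mu)$ be a finite probability space, $n\ge1$, and let $X_t$ be the continuous-time random walk on the general hypercube $(\Omega^n,\mu^{\otimes n})$ with $X_0$ distributed according to the product measure $\mu^{\otimes n}$. Let $a,b\ge0$ and $\tau>0$. Then for any $A,B\subseteq\Omega^n$ with $\mu^{\otimes n}\{A\}=e^{-a^2/2}$ and $\mu^{\otimes n}\{B\}=e^{-b^2/2}$, and for $t\ge\tau n$, we have $$\mathbb{P}\{X_0\in A,\ X_t\in B\}\ge\exp\left(-\frac{(2-e^{-\tau})(a^2+b^2)+2e^{-\tau/2}ab}{4(1-e^{-\tau})}\right)\ge e^{-\frac{a^2+b^2-ab}{4}}\exp\left(-\frac{(a+b)^2}{4(1-e^{-\tau})}\right).$$
   Context: The continuous-time random walk on $(\Omega^n,\mu^{\otimes n})$: at each ring of a Poisson clock of intensity $1$, one coordinate is selected uniformly at random and updated (resampled) according to the distribution $\mu$, independently of everything else. It is reversible with invariant distribution $\mu^{\otimes n}$, and its semigroup is $T^{\mathrm{prod}}_t=\bigotimes_{i=1}^nT_{t/n}$, where $T_s=e^{-s(Id-\mathbb{E}_\mu)}$. All atoms of $\mu$ are assumed to have positive mass. *)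

(* Defs.v *)
From HB Require Import structures.
From mathcomp Require Import all_boot all_order all_algebra.
From mathcomp Require Import all_classical all_reals all_analysis.

Set Implicit Arguments.
Unset Strict Implicit.
Unset Printing Implicit Defensive.

Import Order.TTheory GRing.Theory Num.Theory.
Import numFieldNormedType.Exports.

Local Open Scope classical_set_scope.
Local Open Scope ring_scope.

(* [Omega ^ n] is MathComp's {ffun 'I_n -> Omega}. *)
Definition product_mass (R : realType) (Omega : finType) (n : nat)
    (mu : Omega -> R) (A : {set Omega ^ n}) : R :=
  \sum_(x in A) \prod_(i < n) mu (x i).

Section Probability.
Context {d : measure_display} {T : measurableType d} {R : realType}.
Variable P : probability T R.

Definition discrete_rv (S : Type) (Y : T -> S) : Prop :=
  forall y, measurable (Y @^-1` [set y]).

(* For a discrete random variable these events form the sigma-algebra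
   generated by Y. *)
Definition events_of (S : Type) (Y : T -> S) : set (set T) :=
  [set Y @^-1` V | V in [set: set S]].

(* Product rule over every finite subfamily; the injection j enumerates the
   subfamily. *)
Definition mutually_independent (J : Type) (F : J -> set (set T)) : Prop :=
  forall (m : nat) (j : 'I_m -> J) (E : 'I_m -> set T), injective j ->
    (forall i, F (j i) (E i)) ->
    P (\bigcap_i E i) = (\prod_(i < m) P (E i))%E.

(* N s w is the number of rings in ]0, s]. Truncated subtraction is harmless
   since the paths are nondecreasing. The increment law is only required for
   s < t because [poisson_pmf r] is a junk value when r <= 0. *)
Record poisson_clock (N : R -> T -> nat) : Prop := PoissonClock {
  clock_rv : forall t, 0 <= t -> discrete_rv (N t);
  clock0 : forall w, N 0 w = 0%N;
  clock_nondecreasing : forall w s t, 0 <= s -> s <= t -> (N s w <= N t w)%N;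
  clock_right_continuous : forall w t, 0 <= t ->
    \forall s \near t^'+, N s w = N t w;
  clock_increment : forall s t k, 0 <= s -> s < t ->
    P [set w | (N t w - N s w)%N = k] = (poisson_pmf (t - s) k)%:E;
  clock_independent_increments : forall u : nat -> R,
    0 <= u 0%N -> (forall i, u i <= u i.+1) ->
    mutually_independent
      (fun i => events_of (fun w => (N (u i.+1) w - N (u i) w)%N)) }.

Definition clock_events (N : R -> T -> nat) : set (set T) :=
  <<s \bigcup_(t in [set t | 0 <= t]) events_of (N t) >>.

Section Walk.
Context {Omega : finType} {n : nat}.

Definition resample (x : Omega ^ n) (i : 'I_n) (v : Omega) : Omega ^ n :=
  [ffun j => if j == i then v else x j].

Fixpoint jump_chain (Y0 : T -> Omega ^ n) (I : nat -> T -> 'I_n)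
    (V : nat -> T -> Omega) (k : nat) (w : T) : Omega ^ n :=
  if k is k'.+1 then resample (jump_chain Y0 I V k' w) (I k' w) (V k' w)
  else Y0 w.

Inductive source := Start | Clock | Coord of nat | Fresh of nat.

Definition source_events (N : R -> T -> nat) (Y0 : T -> Omega ^ n)
    (I : nat -> T -> 'I_n) (V : nat -> T -> Omega) (j : source) :
    set (set T) :=
  match j with
  | Start => events_of Y0
  | Clock => clock_events N
  | Coord k => events_of (I k)
  | Fresh k => events_of (V k)
  end.

(* The (k+1)-st ring resamples coordinate [I k] to the value [V k]. The law
   of X 0 is left free. *)
Definition hypercube_walk (mu : Omega -> R) (X : R -> T -> Omega ^ n) : Prop :=
  exists (N : R -> T -> nat) (I : nat -> T -> 'I_n) (V : nat -> T -> Omega),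
  [/\ [/\ poisson_clock N, discrete_rv (X 0), forall k, discrete_rv (I k)
        & forall k, discrete_rv (V k)],
      forall k i, P [set w | I k w = i] = (n%:R^-1)%:E,
      forall k v, P [set w | V k w = v] = (mu v)%:E,
      mutually_independent (source_events N (X 0) I V)
    & forall t w, 0 <= t -> X t w = jump_chain (X 0) I V (N t w) w].

End Walk.
End Probability.

(* Main.v *)
Require Import Defs.
From HB Require Import structures.
From mathcomp Require Import all_boot all_order all_algebra.
From mathcomp Require Import all_classical all_reals all_analysis.
From mathcomp Require Import ring lra.

(** Conditionally on the number and the positions of the rings, [X t] keeps the
    coordinates of [X 0] that were never selected and has fresh ones elsewhere.
    Under Poisson rings each coordinate is untouched with probability
    [lam = exp (- t / n)], independently of the others, so the joint law of
    [X 0] and [X t] is a product over coordinates of the law of a pair [(u, v)]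
    in which [v] is [u] with probability [lam] and a fresh draw otherwise
    ([walk_two_time_lower_bound], with [chain_kernelE] and
    [poisson_chain_kernel]).

    The analytic input is a reverse hypercontractive inequality in two-function
    form: if [lam = (1 - 1/U) (1 - 1/V)] with [U, V > 1], then
    [E (f T g) >= (E f^p)^(1/p) (E g^q)^(1/q)] for nonnegative [f] and [g],
    where [1/p = (U + 1) / 2], [1/q = (V + 1) / 2] and
    [T g = lam g + (1 - lam) E g]. In this form it tensorizes immediately: the
    inequality for one factor is applied with the variables of the other
    factors frozen, then once more to the partial norms
    ([reverse_hypercontractive_prod]). On one factor it splits symmetrically:
    [T] is the composition of the self-adjoint operators with parameters
    [1 - 1/U] and [1 - 1/V], Jensen's inequality bounds the mean of a product
    below by the exponential of the mean logarithm, and what remains is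
    [exp (E ln ((1 - 1/U) f + E f / U)) >= (E f^p)^(1/p)]
    ([geometric_mean_lower_bound]). Normalizing [E f = 1], this inequality is
    the mean of a pointwise inequality between real numbers,
    [simple_log_lower_bound], which is checked by calculus.

    For indicators of [A] and [B] the inequality reads
    [P (X 0 in A, X t in B) >= exp (- (a^2 (U + 1) + b^2 (V + 1)) / 4)]. With
    [rho^2 = lam], the optimal choice
    [U = (a + rho b) / (a (1 - rho^2))], [V = (b + rho a) / (b (1 - rho^2))]
    gives the exponent [noise_exponent], which is monotone in [rho], so that
    [t / n] may be lowered to [tau]. *)

Set Implicit Arguments.
Unset Strict Implicit.
Unset Printing Implicit Defensive.

Import Order.TTheory GRing.Theory Num.Theory.
Import numFieldNormedType.Exports.

Local Open Scope classical_set_scope.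
Local Open Scope ring_scope.

(** * A scalar inequality *)

Lemma le_of_derive_ge0 (R : realType) (f df : R -> R) (a b : R) :
  (forall x : R, is_derive x 1 f (df x)) ->
  (forall x : R, a <= x -> x <= b -> 0 <= df x) -> a <= b -> f a <= f b.
Proof.
move=> fdf df0 ab.
have [|c] := @MVT_segment R f df a b ab (fun x _ => fdf x).
  by apply: derivable_within_continuous => x _; exact: ex_derive.
rewrite in_itv /= => /andP[ac cb] fba.
by rewrite -subr_ge0 fba mulr_ge0 ?subr_ge0// df0.
Qed.

Lemma is_derive_ln_comp (R : realType) (f : R -> R) (x df : R) :
  0 < f x -> is_derive x 1 f df -> is_derive x 1 (fun y => ln (f y)) (df / f x).
Proof.
move=> fx0 fdf.
have := @is_derive1_comp R (@ln R) f x (f x)^-1 df (is_derive1_ln fx0) fdf.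
by rewrite [X in is_derive _ _ _ X -> _]mulrC.
Qed.

Lemma is_derive_scale (R : realType) (c x : R) :
  is_derive x 1 (fun y : R => c * y) c.
Proof.
have := @is_deriveZ R R R id c x 1 1 (is_derive_id x 1).
by rewrite [X in is_derive _ _ _ X -> _](mulr1 c).
Qed.

Lemma is_derive_affine_expR (R : realType) (k c e x : R) :
  is_derive x 1 (fun y : R => c * expR (k * y) + e) (c * (expR (k * x) * k)).
Proof.
have := is_deriveD (is_deriveZ c (is_derive1_comp (is_derive_expR (k * x))
  (is_derive_scale k x))) (is_derive_cst e x (1 : R)).
by rewrite [X in is_derive _ _ _ X -> _]addr0.
Qed.

(** The difference of the two sides vanishes at [x = 0]; its derivative is
    [exp (2 x / (U + 1)) (exp (L x) - 1)] for an explicit function [L] with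
    [L 0 = 0]. The function [L] is nondecreasing because the numerator of its
    derivative is a positive multiple of [(U - 1)^2 (exp x - 1)^2 + U]. Hence
    the difference decreases before [0] and increases after it. *)
Lemma simple_log_lower_bound_expR (R : realType) (U : R) (x : R) : 1 < U ->
  (U + 1) / 2 * (expR (2 / (U + 1) * x) - 1)
    <= (expR x - 1) / U + ln (((U - 1) * expR x + 1) / U).
Proof.
move=> U1.
(* The factor 1 in [1 * y] is the slope expected by [is_derive_affine_expR]. *)
pose N y : R := (U - 1) * expR (1 * y) + (U ^+ 2 - U + 1).
pose M y : R := U * (U - 1) * expR (1 * y) + U.
have M0 y : 0 < M y by rewrite /M ltr_pwDr ?mulr_ge0 ?expR_ge0//; lra.
have N0 y : 0 < N y.
  by rewrite /N ltr_wpDl//; [rewrite mulr_ge0 ?expR_ge0//; lra| nra].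
pose L y : R := (U - 1) / (U + 1) * y + (ln (N y) - ln (M y)).
pose dL y : R := (U - 1) / (U + 1)
  + ((U - 1) * (expR (1 * y) * 1) / N y - U * (U - 1) * (expR (1 * y) * 1) / M y).
have Ld (y : R) : is_derive y 1 L (dL y).
  by apply: is_deriveD (is_derive_scale _ _) (is_deriveB _ _);
    apply: is_derive_ln_comp => //; exact: is_derive_affine_expR.
have dL0 y : 0 <= dL y.
  rewrite /dL mulr1.
  move: (M0 y) (N0 y); rewrite /M /N; move: (expR _) (expR_gt0 (1 * y)) => E E0 M0' N0'.
  have -> : (U - 1) / (U + 1)
  + ((U - 1) * E / ((U - 1) * E + (U ^+ 2 - U + 1))
     - U * (U - 1) * E / (U * (U - 1) * E + U))
   = (U - 1) * ((U - 1) ^+ 2 * (E - 1) ^+ 2 + U) /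
     ((U + 1) * ((U - 1) * E + (U ^+ 2 - U + 1)) * ((U - 1) * E + 1)).
    by field; rewrite !gt_eqF//; nra.
  apply: divr_ge0; apply: mulr_ge0; [lra | | | nra].
    by have := sqr_ge0 ((U - 1) * (E - 1)); rewrite exprMn; lra.
  by apply: mulr_ge0; [lra | exact: ltW].
have L0 : L 0 = 0.
  rewrite /L /N /M mulr0 mulr0 expR0 add0r.
  have NE : (U - 1) * 1 + (U ^+ 2 - U + 1) = U * U by ring.
  have ME : U * (U - 1) * 1 + U = U * U by ring.
  by rewrite NE ME subrr.
have Lge0 y : 0 <= y -> 0 <= L y.
  by move=> y0; rewrite -L0; apply: (le_of_derive_ge0 Ld).
have Lle0 y : y <= 0 -> L y <= 0.
  by move=> y0; rewrite -L0; apply: (le_of_derive_ge0 Ld).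
pose p := 2 / (U + 1); pose u := (U + 1) / 2.
have up : u * p = 1 by rewrite /u /p; field; lra.
pose g y := (U - 1) / U * expR (1 * y) + U^-1.
have gM y : g y = M y / U ^+ 2 by rewrite /g /M; field; lra.
have g0 y : 0 < g y by rewrite gM divr_gt0// exprn_gt0//; lra.
pose F y := (U^-1 * expR (1 * y) - U^-1) + (ln (g y) - (u * expR (p * y) - u)).
pose dF y := U^-1 * (expR (1 * y) * 1)
  + ((U - 1) / U * (expR (1 * y) * 1) / g y - u * (expR (p * y) * p)).
have Fd (y : R) : is_derive y 1 F (dF y).
  apply: is_deriveD (is_derive_affine_expR _ _ _ _) (is_deriveB _ _).
    by apply: is_derive_ln_comp => //; exact: is_derive_affine_expR.
  exact: is_derive_affine_expR.
have dFE y : dF y = expR (p * y) * (expR (L y) - 1).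
  have -> : L y = - (p * y) + (1 * y) + (ln (N y) - ln (M y)).
    by rewrite /L /p; field; lra.
  rewrite expRD expRB !lnK ?posrE// expRD mulrBr !mulrA expRxMexpNx_1 mul1r.
  rewrite /dF gM /M /N (mulrCA u) up !mulr1.
  by move: (M0 y); rewrite /M !mul1r => M0y; field; rewrite !gt_eqF//; nra.
have F0 : F 0 = 0.
  rewrite /F gM /M !mulr0 expR0 !mulr1 !subrr subr0 add0r.
  have -> : (U * (U - 1) + U) / U ^+ 2 = 1 by field; lra.
  by rewrite ln1.
suff : F 0 <= F x.
  have -> : ((U - 1) * expR x + 1) / U = g x.
    by rewrite /g mul1r; field; lra.
  rewrite F0 /F mul1r -/p -/u => F0x; rewrite -subr_ge0 (le_trans F0x)//.
  by rewrite le_eqVlt; apply/orP; left; apply/eqP; ring.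
have [x0|x0] := leP 0 x.
  apply: (le_of_derive_ge0 Fd) => // y y0 _.
  by rewrite dFE mulr_ge0 ?expR_ge0// subr_ge0 -expR0 ler_expR Lge0.
have Fdn (y : R) : is_derive y 1 (fun z => - F z) (- dF y) := is_deriveN (Fd y).
rewrite -lerN2; apply: (le_of_derive_ge0 Fdn) (ltW x0) => y _ y0.
by rewrite dFE -mulrN mulr_ge0 ?expR_ge0// oppr_ge0 subr_le0 -expR0 ler_expR Lle0.
Qed.

(** The change of variables [phi^((U + 1) / 2) = exp x] covers [phi > 0]. The
    case [phi = 0] is its limit as [x] tends to minus infinity, where the
    logarithm is estimated by [ln (1 + z) <= z]. *)
Lemma simple_log_lower_bound (R : realType) (U phi : R) : 1 < U -> 0 <= phi ->
  (U + 1) / 2 * (phi - 1)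
    <= (phi `^ ((U + 1) / 2) - 1) / U
       + ln (((U - 1) * phi `^ ((U + 1) / 2) + 1) / U).
Proof.
move=> U1; rewrite le_eqVlt => /predU1P[<-|phi0]; last first.
  have -> : phi `^ ((U + 1) / 2) = expR ((U + 1) / 2 * ln phi).
    by rewrite /powR gt_eqF.
  have := simple_log_lower_bound_expR ((U + 1) / 2 * ln phi) U1.
  have -> : 2 / (U + 1) * ((U + 1) / 2 * ln phi) = ln phi by field; lra.
  by rewrite lnK ?posrE.
rewrite powR0; last by rewrite gt_eqF//; lra.
rewrite mulr0 !add0r div1r; apply/ler_addgt0Pr => e e0.
pose c := U^-1 + (U - 1).
have c0 : 0 < c by rewrite ltr_wpDl ?invr_ge0//; lra.
have := simple_log_lower_bound_expR (ln (e / c)) U1.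
have E0 : 0 < e / c by rewrite divr_gt0.
rewrite lnK ?posrE//; set p := 2 / _ * _.
have Ui0 : 0 < U^-1 by rewrite invr_gt0; lra.
have h : 0 <= (U - 1) * (e / c) by rewrite mulr_ge0 ?(ltW E0)//; lra.
rewrite lnM ?posrE ?ltr_wpDl//.
have : ln ((U - 1) * (e / c) + 1) <= (U - 1) * (e / c).
  by rewrite addrC le_ln1Dx//; lra.
(* [c] is chosen so that the error at [exp x = e / c] is exactly [e]. *)
have ec : e = (U - 1) * (e / c) + (e / c) / U.
  by rewrite /c; field; rewrite -/c; apply/andP; split; nra.
have : 0 <= (U + 1) / 2 * expR p by rewrite mulr_ge0 ?expR_ge0//; lra.
lra.
Qed.

(** * Reverse hypercontractivity on one factor *)

Lemma expR_mean_le (R : realType) (S : finType) (m h : S -> R) :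
  (forall x, 0 <= m x) -> \sum_x m x = 1 ->
  expR (\sum_x m x * h x) <= \sum_x m x * expR (h x).
Proof.
move=> m0 m1; set l := \sum_x m x * h x.
have -> : expR l = \sum_x m x * (expR l * (1 + (h x - l))).
  under eq_bigr do rewrite mulrCA.
  rewrite -mulr_sumr -[LHS]mulr1; congr (_ * _).
  under eq_bigr do rewrite mulrDr mulr1 mulrBr.
  by rewrite big_split /= sumrB -mulr_suml m1 mul1r subrr addr0.
apply: ler_sum => x _; rewrite ler_wpM2l//.
rewrite -[in leRHS](subrKC l (h x)) expRD.
by rewrite ler_wpM2l ?expR_ge0// expR_ge1Dx.
Qed.

(** A lower bound for the geometric mean of a noisy function. After dividing
    [phi^((U + 1) / 2)] by its mean [M], the mean of [simple_log_lower_bound]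
    loses the linear term [(phi^((U + 1) / 2) - 1) / U], and
    [z^w <= exp (w (z - 1))] turns the remaining inequality into this one. *)
Lemma geometric_mean_lower_bound (R : realType) (S : finType) (m phi : S -> R)
    (U : R) (M := \sum_x m x * phi x `^ ((U + 1) / 2)) :
  (forall x, 0 <= m x) -> \sum_x m x = 1 -> 1 < U -> (forall x, 0 <= phi x) ->
  0 < M ->
  (\sum_x m x * phi x) `^ ((U + 1) / 2) <=
  M * expR (\sum_x m x * ln ((1 - U^-1) * (phi x `^ ((U + 1) / 2) / M) + U^-1)).
Proof.
move=> m0 m1 U1 phi0 M0; set u := (U + 1) / 2.
have u0 : 0 < u by rewrite /u; lra.
pose c := M `^ u^-1.
have c0 : 0 < c by rewrite powR_gt0.
have cu : c `^ u = M by rewrite -powRrM mulVf ?gt_eqF// powRr1// ltW.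
pose psi x := phi x / c.
have psiu x : psi x `^ u = phi x `^ u / M.
  have cVu : c^-1 `^ u = M^-1.
    rewrite -(powR_inv1 (ltW c0)) -powRrM [-1 * u]mulrC powRrM cu.
    by rewrite powR_inv1 ?ltW.
  by rewrite powRM ?invr_ge0 ?(ltW c0)// cVu.
have psi0 x : 0 <= psi x by rewrite divr_ge0// ltW.
have -> : \sum_x m x * phi x = c * \sum_x m x * psi x.
  rewrite mulr_sumr; apply: eq_bigr => x _; rewrite /psi.
  by field; rewrite gt_eqF.
have z0 : 0 <= \sum_x m x * psi x by apply: sumr_ge0 => x _; rewrite mulr_ge0.
rewrite powRM ?(ltW c0)// cu ler_pM2l//.
apply: (@le_trans _ _ (expR (u * (\sum_x m x * psi x - 1)))).
  move: z0; rewrite le_eqVlt => /predU1P[<-|z0].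
    by rewrite powR0 ?gt_eqF// expR_ge0.
  rewrite /powR gt_eqF// ler_expR ler_pM2l//.
  by have := @le_ln1Dx R (\sum_x m x * psi x - 1); rewrite addrCA subrr addr0; apply; lra.
rewrite ler_expR.
have -> : u * (\sum_x m x * psi x - 1) = \sum_x m x * (u * (psi x - 1)).
  under [RHS]eq_bigr do rewrite mulrCA mulrBr mulr1.
  by rewrite -mulr_sumr sumrB m1.
have -> : \sum_x m x * ln ((1 - U^-1) * (phi x `^ u / M) + U^-1) =
  \sum_x m x * ((psi x `^ u - 1) / U + ln (((U - 1) * psi x `^ u + 1) / U)).
  under [RHS]eq_bigr do rewrite mulrDr.
  rewrite big_split/= [X in _ = X + _](_ : _ = 0) ?add0r; last first.
    under eq_bigr do rewrite mulrA mulrBr mulr1 psiu mulrA mulrBl.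
    by rewrite sumrB -!mulr_suml divff ?gt_eqF// m1 subrr.
  apply: eq_bigr => x _; rewrite psiu; congr (_ * ln _); field.
  by apply/andP; split; lra.
apply: ler_sum => x _; rewrite ler_wpM2l//.
exact: simple_log_lower_bound.
Qed.

(** The substitution [f = phi^u], [g = gam^v] replaces the norms of [f] and [g]
    of exponents [1 / u] and [1 / v], so that no root has to be composed
    with a power when the property is iterated over factors. *)
Definition reverse_hypercontractive (R : realType) (S : finType) (m : S -> R)
    (r : S -> S -> R) (u v : R) : Prop :=
  forall phi gam : S -> R, (forall x, 0 <= phi x) -> (forall x, 0 <= gam x) ->
  (\sum_x m x * phi x) `^ u * (\sum_x m x * gam x) `^ v <=
  \sum_x \sum_y r x y * (phi x `^ u * gam y `^ v).

Definition lazy_kernel (R : realType) (S : finType) (m : S -> R) (lam : R)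
    (x y : S) : R := lam * (x == y)%:R + (1 - lam) * m y.

Lemma sum_lazy_kernel (R : realType) (S : finType) (m f g : S -> R) (lam : R) :
  \sum_x \sum_y m x * lazy_kernel m lam x y * (f x * g y) =
  lam * (\sum_x m x * (f x * g x))
  + (1 - lam) * ((\sum_x m x * f x) * (\sum_x m x * g x)).
Proof.
rewrite mulr_suml !mulr_sumr -big_split/=; apply: eq_bigr => x _.
rewrite mulr_sumr mulr_sumr /lazy_kernel.
under eq_bigr => y _.
  have -> : m x * (lam * (x == y)%:R + (1 - lam) * m y) * (f x * g y) =
    (if y == x then lam * (m x * (f x * g y)) else 0)
    + (1 - lam) * (m x * f x * (m y * g y)).
    by rewrite eq_sym; case: eqP => _; rewrite /= ?mulr1n ?mulr0n; ring.
  over.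
by rewrite big_split/= -big_mkcond big_pred1_eq.
Qed.

Lemma mean_powR_eq0 (R : realType) (S : finType) (m phi : S -> R) (u : R) :
  0 < u -> (forall x, 0 <= m x) -> (forall x, 0 <= phi x) ->
  \sum_x m x * phi x `^ u = 0 -> (\sum_x m x * phi x) `^ u = 0.
Proof.
move=> u0 m0 phi0 /eqP; rewrite psumr_eq0; last first.
  by move=> x _; rewrite mulr_ge0 ?powR_ge0.
move=> /allP h; rewrite big1 ?powR0 ?gt_eqF// => x _.
have := h x (mem_index_enum x); rewrite /= mulf_eq0 powR_eq0 (gt_eqF u0) andbT.
by case/orP => /eqP ->; rewrite ?mul0r ?mulr0.
Qed.

(** With [f] and [g] divided by their means, the two-point mean of the lazy
    kernel is the mean of [Tf * Tg], where [Tf] and [Tg] are the noisy versions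
    of [f] and [g] with parameters [1 - 1/U] and [1 - 1/V]: noise parameters
    multiply. Jensen's inequality then separates the two functions. *)
Lemma lazy_kernel_reverse_hypercontractive (R : realType) (S : finType)
    (m : S -> R) (U V : R) :
  (forall x, 0 <= m x) -> \sum_x m x = 1 -> 1 < U -> 1 < V ->
  reverse_hypercontractive m
    (fun x y => m x * lazy_kernel m ((1 - U^-1) * (1 - V^-1)) x y)
    ((U + 1) / 2) ((V + 1) / 2).
Proof.
move=> m0 m1 U1 V1 phi gam phi0 gam0.
set u := (U + 1) / 2; set v := (V + 1) / 2.
have u0 : 0 < u by rewrite /u; lra.
have v0 : 0 < v by rewrite /v; lra.
have Ui : 0 < U^-1 < 1 by rewrite invr_gt0 invf_lt1 ?U1 ?andbT; lra.
have Vi : 0 < V^-1 < 1 by rewrite invr_gt0 invf_lt1 ?V1 ?andbT; lra.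
rewrite sum_lazy_kernel.
set Mf := \sum_x m x * phi x `^ u; set Mg := \sum_x m x * gam x `^ v.
have Mf0 : 0 <= Mf by apply: sumr_ge0 => x _; rewrite mulr_ge0 ?powR_ge0.
have Mg0 : 0 <= Mg by apply: sumr_ge0 => x _; rewrite mulr_ge0 ?powR_ge0.
have rhs0 : 0 <= (1 - U^-1) * (1 - V^-1) * (\sum_x m x * (phi x `^ u * gam x `^ v)) +
   (1 - (1 - U^-1) * (1 - V^-1)) * (Mf * Mg).
  apply: addr_ge0; apply: mulr_ge0; [nra| |nra|exact: mulr_ge0].
  by apply: sumr_ge0 => x _; rewrite !mulr_ge0 ?powR_ge0.
have [fz|fnz] := eqVneq Mf 0; first by rewrite (mean_powR_eq0 u0 m0 phi0 fz) mul0r.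
have [gz|gnz] := eqVneq Mg 0; first by rewrite (mean_powR_eq0 v0 m0 gam0 gz) mulr0.
have {fnz}Mf0 : 0 < Mf by rewrite lt_neqAle eq_sym fnz.
have {gnz}Mg0 : 0 < Mg by rewrite lt_neqAle eq_sym gnz.
pose Tf x := (1 - U^-1) * (phi x `^ u / Mf) + U^-1.
pose Tg x := (1 - V^-1) * (gam x `^ v / Mg) + V^-1.
have Tf0 x : 0 < Tf x.
  by rewrite /Tf ltr_wpDl ?mulr_ge0 ?powR_ge0 ?invr_ge0 ?(ltW Mf0)//; lra.
have Tg0 x : 0 < Tg x.
  by rewrite /Tg ltr_wpDl ?mulr_ge0 ?powR_ge0 ?invr_ge0 ?(ltW Mg0)//; lra.
apply: (@le_trans _ _ ((Mf * expR (\sum_x m x * ln (Tf x)))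
                      * (Mg * expR (\sum_x m x * ln (Tg x))))).
  by apply: ler_pM; rewrite ?powR_ge0//; exact: geometric_mean_lower_bound.
rewrite mulrACA -expRD -big_split/=.
apply: (@le_trans _ _ (Mf * Mg * \sum_x m x * (Tf x * Tg x))).
  rewrite ler_wpM2l ?mulr_ge0 ?(ltW Mf0) ?(ltW Mg0)//.
  have := @expR_mean_le R S m (fun x => ln (Tf x) + ln (Tg x)) m0 m1.
  rewrite (eq_bigr _ (fun x _ => mulrDr (m x) _ _)).
  move=> /le_trans; apply; apply: ler_sum => x _.
  by rewrite expRD !lnK ?posrE.
rewrite le_eqVlt; apply/orP; left; apply/eqP.
have fE : \sum_x m x * phi x `^ u = Mf by [].
have gE : \sum_x m x * gam x `^ v = Mg by [].
clearbody Mf Mg.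
have -> : \sum_x m x * (Tf x * Tg x) =
  (1 - U^-1) * (1 - V^-1) / (Mf * Mg) * (\sum_x m x * (phi x `^ u * gam x `^ v))
  + (1 - U^-1) * V^-1 / Mf * (\sum_x m x * phi x `^ u)
  + U^-1 * (1 - V^-1) / Mg * (\sum_x m x * gam x `^ v)
  + U^-1 * V^-1 * (\sum_x m x).
  rewrite !mulr_sumr -!big_split/=; apply: eq_bigr => x _.
  rewrite /Tf /Tg; field.
  by rewrite !gt_eqF//; lra.
rewrite fE gE m1; field.
by rewrite !gt_eqF//; lra.
Qed.

(** * Tensorization *)

(** With the first coordinates of both arguments frozen, the second factor
    replaces [phi] and [gam] by their partial means, to which the first factor
    applies. *)
Lemma reverse_hypercontractive_prod (R : realType) (S1 S2 : finType)
    (m1 : S1 -> R) (m2 : S2 -> R) (r1 : S1 -> S1 -> R) (r2 : S2 -> S2 -> R)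
    (u v : R) :
  (forall x, 0 <= m2 x) -> (forall x y, 0 <= r1 x y) ->
  reverse_hypercontractive m1 r1 u v -> reverse_hypercontractive m2 r2 u v ->
  reverse_hypercontractive (fun x : S1 * S2 => m1 x.1 * m2 x.2)
    (fun x y => r1 x.1 y.1 * r2 x.2 y.2) u v.
Proof.
move=> m2_0 r1_0 H1 H2 phi gam phi0 gam0.
pose Phi (f : S1 * S2 -> R) x := \sum_y m2 y * f (x, y).
have Phi0 f : (forall x, 0 <= f x) -> forall x, 0 <= Phi f x.
  by move=> f0 x; apply: sumr_ge0 => y _; rewrite mulr_ge0.
have PhiE f : \sum_x m1 x.1 * m2 x.2 * f x = \sum_x m1 x * Phi f x.
  rewrite (eq_bigr (fun p => m1 p.1 * m2 p.2 * f (p.1, p.2))) => [|[x y] _ //].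
  rewrite -(pair_bigA _ (fun x y => m1 x * m2 y * f (x, y)))/=.
  by apply: eq_bigr => x _; rewrite mulr_sumr; apply: eq_bigr => y _; rewrite mulrA.
rewrite !PhiE; apply: (le_trans (H1 _ _ (Phi0 _ phi0) (Phi0 _ gam0))).
have -> : \sum_x \sum_y r1 x.1 y.1 * r2 x.2 y.2 * (phi x `^ u * gam y `^ v) =
  \sum_x \sum_x' r1 x x' * (\sum_y \sum_y' r2 y y' *
    (phi (x, y) `^ u * gam (x', y') `^ v)).
  rewrite (eq_bigr (fun p => \sum_q r1 p.1 q.1 * r2 p.2 q.2 *
    (phi (p.1, p.2) `^ u * gam q `^ v))) => [|[x y] _ //].
  rewrite -(pair_bigA _ (fun x y => \sum_q r1 x q.1 * r2 y q.2 *
    (phi (x, y) `^ u * gam q `^ v)))/=.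
  apply: eq_bigr => x _.
  under eq_bigr => y _.
    rewrite (eq_bigr (fun q => r1 x q.1 * r2 y q.2 *
      (phi (x, y) `^ u * gam (q.1, q.2) `^ v))) => [|[x' y'] _ //].
    rewrite -(pair_bigA _ (fun x' y' => r1 x x' * r2 y y' *
      (phi (x, y) `^ u * gam (x', y') `^ v)))/=.
    over.
  rewrite exchange_big/=; apply: eq_bigr => x' _.
  rewrite mulr_sumr; apply: eq_bigr => y _.
  by rewrite mulr_sumr; under eq_bigr do rewrite -mulrA.
apply: ler_sum => x _; apply: ler_sum => x' _; rewrite ler_wpM2l//.
exact: (H2 (fun y => phi (x, y)) (fun y => gam (x', y))).
Qed.

Lemma reverse_hypercontractive_bij (R : realType) (S S' : finType)
    (e : S' -> S) (m : S -> R) (r : S -> S -> R) (u v : R) : bijective e ->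
  reverse_hypercontractive (m \o e) (fun x y => r (e x) (e y)) u v ->
  reverse_hypercontractive m r u v.
Proof.
move=> [e' eK e'K] H phi gam phi0 gam0.
have := H (phi \o e) (gam \o e) (fun x => phi0 _) (fun x => gam0 _).
have bije : {on predT, bijective e} by exists e' => x _.
rewrite 2!(reindex e bije)/= => /le_trans; apply.
rewrite (reindex e bije)/=; apply: ler_sum => x _.
by rewrite (reindex e bije).
Qed.

Definition ffun_cons (S : finType) (n : nat) (p : S * S ^ n) : S ^ n.+1 :=
  [ffun i => if unlift ord0 i is Some j then p.2 j else p.1].

Lemma ffun_cons0 (S : finType) (n : nat) (p : S * S ^ n) :
  ffun_cons p ord0 = p.1.
Proof. by rewrite ffunE unlift_none. Qed.

Lemma ffun_cons_lift (S : finType) (n : nat) (p : S * S ^ n) (j : 'I_n) :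
  ffun_cons p (lift ord0 j) = p.2 j.
Proof. by rewrite ffunE liftK. Qed.

Lemma ffun_cons_bij (S : finType) (n : nat) : bijective (@ffun_cons S n).
Proof.
exists (fun x : S ^ n.+1 => (x ord0, [ffun j : 'I_n => x (lift ord0 j)])).
  move=> [v x]; rewrite ffun_cons0; congr (_, _); apply/ffunP => j.
  by rewrite ffunE ffun_cons_lift.
move=> x; apply/ffunP => i; have [j ->|->] := unliftP ord0 i.
  by rewrite ffun_cons_lift ffunE.
by rewrite ffun_cons0.
Qed.

Lemma reverse_hypercontractive_power (R : realType) (S : finType) (m : S -> R)
    (r : S -> S -> R) (u v : R) (n : nat) :
  (forall x, 0 <= m x) -> (forall x y, 0 <= r x y) ->
  reverse_hypercontractive m r u v ->
  reverse_hypercontractive (fun x : S ^ n => \prod_i m (x i))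
    (fun x y => \prod_i r (x i) (y i)) u v.
Proof.
move=> m0 r0 H; elim: n => [|n IH].
  move=> phi gam phi0 gam0.
  have [x0 _] : exists x0 : S ^ 0, true.
    by exists (finfun (fun i : 'I_0 => False_rect S (notF (ltn_ord i)))).
  have sum1 (F : S ^ 0 -> R) : \sum_x F x = F x0.
    by apply: big_pred1 => x; rewrite /= eq_sym; apply/esym/eqP/ffunP; case.
  by rewrite !sum1 !big_ord0 !mul1r.
apply: (reverse_hypercontractive_bij (@ffun_cons_bij S n)).
have := reverse_hypercontractive_prod
  (fun x => prodr_ge0 _ (fun i _ => m0 _)) r0 H IH.
congr (reverse_hypercontractive _ _ u v); apply/funext => p.
  rewrite /= big_ord_recl ffun_cons0.
  by under [in RHS]eq_bigr do rewrite ffun_cons_lift.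
apply/funext => q; rewrite big_ord_recl !ffun_cons0.
by under [in RHS]eq_bigr do rewrite !ffun_cons_lift.
Qed.

Definition noise_kernel (R : realType) (S : finType) (m : S -> R) (lam : R)
    (n : nat) (x y : S ^ n) : R :=
  \prod_i lazy_kernel m lam (x i) (y i).

Lemma lazy_kernel_ge0 (R : realType) (S : finType) (m : S -> R) (lam : R) x y :
  (forall x, 0 <= m x) -> 0 <= lam <= 1 -> 0 <= lazy_kernel m lam x y.
Proof.
by move=> m0 /andP[l0 l1]; rewrite addr_ge0 ?mulr_ge0 ?ler0n ?subr_ge0.
Qed.

(** * Lower bound for two sets *)

(** For indicator functions both powers disappear from the right-hand side. *)
Lemma noise_set_lower_bound (R : realType) (S : finType) (m : S -> R)
    (U V : R) (n : nat) (A B : {set S ^ n}) :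
  (forall x, 0 <= m x) -> \sum_x m x = 1 -> 1 < U -> 1 < V ->
  product_mass m A `^ ((U + 1) / 2) * product_mass m B `^ ((V + 1) / 2) <=
  \sum_(x in A) \sum_(y in B) (\prod_i m (x i))
     * noise_kernel m ((1 - U^-1) * (1 - V^-1)) x y.
Proof.
move=> m0 m1 U1 V1; set lam := (1 - U^-1) * (1 - V^-1).
have Ui : 0 < U^-1 < 1 by rewrite invr_gt0 invf_lt1 ?U1 ?andbT; lra.
have Vi : 0 < V^-1 < 1 by rewrite invr_gt0 invf_lt1 ?V1 ?andbT; lra.
have lam01 : 0 <= lam <= 1 by rewrite /lam; nra.
have r0 x y : 0 <= m x * lazy_kernel m lam x y.
  by rewrite mulr_ge0 ?lazy_kernel_ge0.
have := reverse_hypercontractive_power (n := n) m0 r0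
  (lazy_kernel_reverse_hypercontractive m0 m1 U1 V1).
move=> /(_ (fun x => (x \in A)%:R) (fun x => (x \in B)%:R)
  (fun x => ler0n _ _) (fun x => ler0n _ _)).
have massE (C : {set S ^ n}) :
  \sum_(x : S ^ n) (\prod_i m (x i)) * (x \in C)%:R = product_mass m C.
  rewrite /product_mass [RHS]big_mkcond/=; apply: eq_bigr => x _.
  by case: ifP => _; rewrite ?mulr1 ?mulr0.
have powE (b : bool) (w : R) : 1 < w -> (b%:R : R) `^ ((w + 1) / 2) = b%:R.
  by case: b => w1; rewrite /= ?powR1 ?powR0 ?gt_eqF//; lra.
rewrite !massE /= => /le_trans; apply; rewrite le_eqVlt; apply/orP; left; apply/eqP.
rewrite [RHS]big_mkcond/=; apply: eq_bigr => x _; case: ifP => _; last first.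
  by rewrite big1// => y _; rewrite (powE _ _ U1) mul0r mulr0.
rewrite [RHS]big_mkcond/=; apply: eq_bigr => y _.
rewrite powR1 (powE _ _ V1) mul1r big_split/=.
by case: ifP => _; rewrite ?mulr1 ?mulr0.
Qed.

(** The average of the exponent [(a^2 + b^2 + 2 rho a b) / (2 (1 - rho^2))] of
    the Gaussian bound and of the exponent [(a^2 + b^2) / 2] of independent
    sets. *)
Definition noise_exponent (R : realType) (rho a b : R) : R :=
  (a ^+ 2 + b ^+ 2) / 4
  + (a ^+ 2 + b ^+ 2 + 2 * rho * a * b) / (4 * (1 - rho ^+ 2)).

(** The optimal exponents divide by [a] and [b]; computing them from larger
    positive parameters [a'] and [b'] makes sense for [a = 0] or [b = 0] too
    and only weakens the bound. *)
Lemma noise_set_lower_bound_pos (R : realType) (S : finType) (m : S -> R)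
    (rho a b a' b' : R) (n : nat) (A B : {set S ^ n}) :
  (forall x, 0 <= m x) -> \sum_x m x = 1 -> 0 < rho < 1 ->
  0 <= a <= a' -> 0 <= b <= b' -> 0 < a' -> 0 < b' ->
  product_mass m A = expR (- (a ^+ 2 / 2)) ->
  product_mass m B = expR (- (b ^+ 2 / 2)) ->
  expR (- noise_exponent rho a' b') <=
  \sum_(x in A) \sum_(y in B) (\prod_i m (x i)) * noise_kernel m (rho ^+ 2) x y.
Proof.
move=> m0 m1 /andP[r0 r1] /andP[a0 aa'] /andP[b0 bb'] a'0 b'0 mA mB.
have d0 : 0 < 1 - rho ^+ 2 by rewrite subr_gt0 expr_lt1// ltW.
have ab0 : 0 < a' + rho * b' by rewrite addr_gt0// mulr_gt0.
have ba0 : 0 < b' + rho * a' by rewrite addr_gt0// mulr_gt0.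
pose U := (a' + rho * b') / (a' * (1 - rho ^+ 2)).
pose V := (b' + rho * a') / (b' * (1 - rho ^+ 2)).
have U1 : 1 < U.
  by rewrite ltr_pdivlMr ?mulr_gt0// mul1r mulrBr mulr1 ltrD2l; nra.
have V1 : 1 < V.
  by rewrite ltr_pdivlMr ?mulr_gt0// mul1r mulrBr mulr1 ltrD2l; nra.
have lamE : (1 - U^-1) * (1 - V^-1) = rho ^+ 2.
  by rewrite /U /V; field; rewrite !gt_eqF.
have := noise_set_lower_bound A B m0 m1 U1 V1.
rewrite lamE mA mB -!expRM -expRD; apply: le_trans; rewrite ler_expR.
have -> : noise_exponent rho a' b' = (a' ^+ 2 * (U + 1) + b' ^+ 2 * (V + 1)) / 4.
  by rewrite /noise_exponent /U /V; field; rewrite !gt_eqF.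
have aq : a ^+ 2 * (U + 1) <= a' ^+ 2 * (U + 1).
  by rewrite ler_wpM2r ?lerXn2r ?nnegrE//; lra.
have bq : b ^+ 2 * (V + 1) <= b' ^+ 2 * (V + 1).
  by rewrite ler_wpM2r ?lerXn2r ?nnegrE//; lra.
lra.
Qed.

(** The limit of [noise_set_lower_bound_pos] as [a'] and [b'] decrease to [a]
    and [b]. *)
Lemma noise_set_lower_bound_exponent (R : realType) (S : finType) (m : S -> R)
    (rho a b : R) (n : nat) (A B : {set S ^ n}) :
  (forall x, 0 <= m x) -> \sum_x m x = 1 -> 0 < rho < 1 ->
  0 <= a -> 0 <= b ->
  product_mass m A = expR (- (a ^+ 2 / 2)) ->
  product_mass m B = expR (- (b ^+ 2 / 2)) ->
  expR (- noise_exponent rho a b) <=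
  \sum_(x in A) \sum_(y in B) (\prod_i m (x i)) * noise_kernel m (rho ^+ 2) x y.
Proof.
move=> m0 m1 r01 a0 b0 mA mB; set s := \sum_(x in A) _.
have bound e : 0 < e -> expR (- noise_exponent rho (a + e) (b + e)) <= s.
  move=> e0; apply: (noise_set_lower_bound_pos m0 m1 r01 _ _ _ _ mA mB); lra.
have s0 : 0 < s by apply: lt_le_trans (bound 1 ltr01); exact: expR_gt0.
rewrite -[s]lnK ?posrE// ler_expR lerNl; apply/ler_addgt0Pr => e e0.
have /andP[r0 r1] := r01.
have d0 : 0 < 1 - rho ^+ 2 by rewrite subr_gt0 expr_lt1// ltW.
(* [w * (c * (a + b + w))] is the increment of the exponent between [(a, b)]
   and [(a + w, b + w)]. *)
pose c := 2^-1 + (1 + rho) / (2 * (1 - rho ^+ 2)).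
have c0 : 0 < c by rewrite ltr_wpDr// divr_ge0 ?mulr_ge0 ?(ltW d0)//; lra.
pose w := Order.min 1 (e / (c * (a + b + 1))).
have q0 : 0 < c * (a + b + 1) by rewrite mulr_gt0//; lra.
have w0 : 0 < w by rewrite lt_min ltr01 divr_gt0.
have w1 : w <= 1 by rewrite ge_min lexx.
have we : w * (c * (a + b + 1)) <= e by rewrite -ler_pdivlMr// ge_min lexx orbT.
have expE : noise_exponent rho (a + w) (b + w)
  = noise_exponent rho a b + w * (c * (a + b + w)).
  by rewrite /noise_exponent /c; field; rewrite gt_eqF.
have lns : - noise_exponent rho (a + w) (b + w) <= ln s.
  by rewrite -ler_expR lnK ?posrE// bound.
rewrite expE in lns; have : w * (c * (a + b + w)) <= w * (c * (a + b + 1)).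
  by rewrite !ler_pM2l//; lra.
lra.
Qed.

Lemma noise_exponent_le (R : realType) (rho rho' a b : R) :
  0 <= rho <= rho' -> rho' < 1 -> 0 <= a -> 0 <= b ->
  noise_exponent rho a b <= noise_exponent rho' a b.
Proof.
move=> /andP[r0 rr'] r1 a0 b0.
have d0 : 0 < 1 - rho' ^+ 2 by rewrite subr_gt0 expr_lt1//; lra.
have sq : rho ^+ 2 <= rho' ^+ 2 by rewrite lerXn2r ?nnegrE//; lra.
rewrite lerD2l; apply: ler_pM.
- by rewrite !addr_ge0 ?sqr_ge0 ?mulr_ge0.
- by rewrite invr_ge0; lra.
- by rewrite lerD2l !ler_wpM2r//; lra.
- by rewrite lef_pV2 ?posrE; lra.
Qed.

(** * The jump chain and its set of touched coordinates *)

Fixpoint chain_kernel (R : realType) (S : finType) (m : S -> R) (n k : nat)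
    (x y : S ^ n) : R :=
  if k is k'.+1 then
    \sum_z \sum_i \sum_v
      chain_kernel m k' x z * (n%:R^-1 * m v) * (resample z i v == y)%:R
  else (x == y)%:R.

(** The law of the set of the first [k] selected coordinates. *)
Fixpoint touched_law (R : realType) (n k : nat) (A : {set 'I_n}) : R :=
  if k is k'.+1 then
    \sum_B \sum_i touched_law R k' B * n%:R^-1 * (i |: B == A)%:R
  else (A == finset.set0)%:R.

Definition refresh_kernel (R : realType) (S : finType) (m : S -> R) (n : nat)
    (A : {set 'I_n}) (x y : S ^ n) : R :=
  \prod_i (if i \in A then m (y i) else (x i == y i)%:R).

Lemma sum_indicator (R : realType) (T : finType) (x : T) (F : T -> R) :
  \sum_y F y * (y == x)%:R = F x.
Proof.
rewrite (bigD1 x)//= eqxx mulr1 big1 ?addr0// => y yx.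
by rewrite (negbTE yx) mulr0.
Qed.

(** The sum over [z] and [v] factorizes over coordinates, since the indicator
    of [resample z i v = y] does: coordinate [i] of [z] is free, [v] is [y i],
    and the other coordinates of [z] are those of [y]. *)
Lemma refresh_kernel_resample (R : realType) (S : finType) (m : S -> R)
    (n : nat) (A : {set 'I_n}) (i : 'I_n) (x y : S ^ n) :
  \sum_v m v = 1 ->
  \sum_z \sum_v refresh_kernel m A x z * m v * (resample z i v == y)%:R =
  refresh_kernel m (i |: A) x y.
Proof.
move=> m1; rewrite exchange_big/=.
pose f j w : R := if j \in A then m w else (x j == w)%:R.
have f1 : \sum_w f i w = 1.
  rewrite /f; case iA: (i \in A); first by rewrite -[RHS]m1.
  rewrite -[RHS](sum_indicator (x i) (fun=> 1)); apply: eq_bigr => w _.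
  by rewrite mul1r eq_sym.
have indE (z : S ^ n) v : (resample z i v == y)%:R =
    \prod_j (if j == i then v == y i else z j == y j)%:R :> R.
  have [<-|neq] := eqVneq (resample z i v) y.
    by rewrite big1// => j _; rewrite !ffunE eqxx; case: eqP => _; rewrite eqxx.
  have [j jP] : exists j, resample z i v j != y j.
    apply/existsP; rewrite -negb_forall; apply: contra neq => /forallP h.
    by apply/eqP/ffunP => j; apply/eqP.
  rewrite [RHS](bigD1 j)//=; move: jP; rewrite ffunE; have [->|_] := eqVneq j i;
    by move=> /negbTE ->; rewrite mul0r.
transitivity (\sum_v m v * \prod_j \sum_w
    (f j w * (if j == i then v == y i else w == y j)%:R)).
  apply: eq_bigr => v _; rewrite bigA_distr_bigA mulr_sumr; apply: eq_bigr => z _.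
  by rewrite indE big_split/= mulrAC mulrA mulrC mulrA.
transitivity (\sum_v m v * (v == y i)%:R * \prod_(j | j != i) f j (y j)).
  apply: eq_bigr => v _; rewrite (bigD1 i)//= eqxx -mulr_suml f1 mul1r mulrA.
  congr (_ * _); apply: eq_bigr => j ji; rewrite (negbTE ji).
  exact: sum_indicator.
rewrite -mulr_suml sum_indicator /refresh_kernel [RHS](bigD1 i)//= finset.setU11.
congr (_ * _); apply: eq_bigr => j ji.
by rewrite in_setU1 (negbTE ji).
Qed.

(** Only the set of touched coordinates matters, because redrawing coordinate
    [i] after those in [A] amounts to redrawing those in [i |: A]. *)
Lemma chain_kernelE (R : realType) (S : finType) (m : S -> R) (n k : nat)
    (x y : S ^ n) : \sum_v m v = 1 ->
  chain_kernel m k x y =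
  \sum_(A : {set 'I_n}) touched_law R k A * refresh_kernel m A x y.
Proof.
move=> m1; elim: k y => [|k IH] y /=.
  under eq_bigr do rewrite mulrC.
  rewrite sum_indicator /refresh_kernel; under eq_bigr do rewrite finset.in_set0.
  have [->|neq] := eqVneq x y; first by rewrite big1// => i _; rewrite eqxx.
  have [j /negbTE jP] : exists j, x j != y j.
    apply/existsP; rewrite -negb_forall; apply: contra neq => /forallP h.
    by apply/eqP/ffunP => j; apply/eqP.
  by rewrite (bigD1 j)//= jP mul0r.
transitivity (\sum_(B : {set 'I_n}) \sum_(i < n) touched_law R k B * n%:R^-1
    * refresh_kernel m (i |: B) x y).
  under [RHS]eq_bigr => B _ do under eq_bigr => i _ do
    rewrite -(refresh_kernel_resample _ _ _ _ m1) mulr_sumr.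
  under [RHS]eq_bigr => B _ do rewrite exchange_big/=.
  rewrite [RHS]exchange_big/=; apply: eq_bigr => z _.
  rewrite [RHS]exchange_big/=; apply: eq_bigr => i _.
  rewrite IH; under eq_bigr do rewrite mulr_suml mulr_suml.
  rewrite exchange_big/=; apply: eq_bigr => B _.
  by rewrite mulr_sumr; apply: eq_bigr => v _; ring.
under [RHS]eq_bigr => A _ do rewrite mulr_suml.
rewrite [RHS]exchange_big/=; apply: eq_bigr => B _.
under [RHS]eq_bigr => A _ do rewrite mulr_suml.
rewrite [RHS]exchange_big/=; apply: eq_bigr => i _.
under [RHS]eq_bigr => A _ do rewrite mulrAC eq_sym.
by rewrite sum_indicator.
Qed.

(** The cumulative form of [touched_law]: all [k] selections fall in [A]. Being
    a pure power of [k], it is summed against the Poisson weights by the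
    exponential series. *)
Lemma touched_law_subset (R : realType) (n k : nat) (A : {set 'I_n}) :
  \sum_(B : {set 'I_n} | B \subset A) touched_law R k B = (#|A|%:R / n%:R) ^+ k.
Proof.
elim: k => [|k IH] /=.
  rewrite (bigD1 finset.set0) ?finset.sub0set//= eqxx big1 ?addr0// => B /andP[_ /negbTE ->//].
rewrite exchange_big/=.
transitivity (\sum_(B : {set 'I_n}) \sum_(i < n)
    touched_law R k B * n%:R^-1 * ((i \in A) && (B \subset A))%:R).
  apply: eq_bigr => B _; rewrite exchange_big/=; apply: eq_bigr => i _.
  rewrite -mulr_sumr; congr (_ * _).
  have -> : (i \in A) && (B \subset A) = (i |: B \subset A).
    by rewrite finset.subUset finset.sub1set.
  rewrite big_mkcond/= (bigD1 (i |: B))//= eqxx big1 ?addr0; first by case: ifP.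
  by move=> C /negbTE CB; rewrite eq_sym CB; case: ifP.
rewrite exprS -IH mulr_sumr [RHS]big_mkcond/=; apply: eq_bigr => B _.
rewrite -mulr_sumr; case: ifP => BA; last by rewrite big1 ?mulr0// => i _; rewrite andbF.
under eq_bigr do rewrite andbT.
rewrite -natr_sum -big_mkcond/= sum1_card; ring.
Qed.

Lemma poisson_generating_function (R : realType) (t r : R) : 0 < t ->
  (fun K => \sum_(0 <= k < K) poisson_pmf t k * r ^+ k) @ \oo
    --> expR (t * (r - 1)).
Proof.
move=> t0.
have -> : (fun K => \sum_(0 <= k < K) poisson_pmf t k * r ^+ k) =
  (fun K => expR (- t) * series (exp_coeff (t * r)) K).
  apply/funext => K; rewrite /series/= mulr_sumr; apply: eq_bigr => k _.
  by rewrite /poisson_pmf t0 /exp_coeff/= exprMn; ring.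
have -> : expR (t * (r - 1)) = expR (- t) * expR (t * r).
  by rewrite -expRD; congr expR; ring.
exact: cvgM (cvg_cst _) (is_cvg_series_exp_coeff (t * r)).
Qed.

Lemma prodr_if_const (R : realType) (n : nat) (A : {set 'I_n}) (c : R) :
  \prod_(i < n) (if i \in A then 1 else c) = c ^+ (n - #|A|).
Proof.
rewrite (eq_bigr (fun i => if i \in ~: A then c else 1)); last first.
  by move=> i _; rewrite finset.in_setC; case: (i \in A).
by rewrite -big_mkcond prodr_const cardsCs finset.setCK card_ord.
Qed.

(** Over a Poisson number of rings each coordinate is touched independently with
    probability [1 - exp (- t / n)]. A law on sets is determined by the
    probabilities of being contained in [A], for all [A]: both sides have the
    cumulative value [exp (t (#|A| / n - 1))], and the value at [A] itself is
    obtained by subtracting those at proper subsets, by induction on [#|A|]. *)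
Lemma poisson_touched_law (R : realType) (n : nat) (t : R) (A : {set 'I_n}) :
  (0 < n)%N -> 0 < t ->
  (fun K => \sum_(0 <= k < K) poisson_pmf t k * touched_law R k A) @ \oo -->
  \prod_i (if i \in A then 1 - expR (- (t / n%:R)) else expR (- (t / n%:R))).
Proof.
move=> n0 t0; set lam := expR _.
pose w (B : {set 'I_n}) := \prod_i (if i \in B then 1 - lam else lam).
have [N] := ubnP #|A|; elim: N A => // N IH A; rewrite ltnS => AN.
have wE : w A = expR (t * (#|A|%:R / n%:R - 1)) - \sum_(B : {set 'I_n} | B \proper A) w B.
  apply/eqP; rewrite eq_sym subr_eq; apply/eqP.
  transitivity (\sum_(B : {set 'I_n} | B \subset A) w B); last first.
    rewrite (bigD1 A)//=; congr (_ + _); apply: eq_bigl => B.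
    by rewrite finset.properEneq andbC.
  transitivity (\prod_(i < n) ((if i \in A then 1 - lam else 0) + lam)).
    rewrite (eq_bigr (fun i => if i \in A then 1 else lam)) => [|i _]; last first.
      by case: ifP => _; rewrite ?subrK ?add0r.
    rewrite prodr_if_const /lam -expRM_natr natrB; last first.
      by rewrite -[leqRHS]card_ord max_card.
    by congr expR; field; rewrite pnatr_eq0 -lt0n.
  rewrite bigA_distr [RHS]big_mkcond/=; apply: eq_big => // B _.
  case: ifPn => [BA|/subsetPn[i iB iA]].
    apply: eq_bigr => i _; case: ifPn => // iB.
    by rewrite (fintype.subsetP BA _ iB).
  by rewrite (bigD1 i)//= iB (negbTE iA) mul0r.
rewrite -/(w A) wE.
have -> : (fun K => \sum_(0 <= k < K) poisson_pmf t k * touched_law R k A) =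
  (fun K => \sum_(0 <= k < K) poisson_pmf t k * (#|A|%:R / n%:R) ^+ k
   - \sum_(B : {set 'I_n} | B \proper A)
       \sum_(0 <= k < K) poisson_pmf t k * touched_law R k B).
  apply/funext => K; rewrite exchange_big/= -sumrB; apply: eq_bigr => k _.
  rewrite -touched_law_subset (bigD1 A)//= -mulr_sumr -mulrBr; congr (_ * _).
  rewrite [X in _ + X - _](eq_bigl (fun B : {set 'I_n} => B \proper A)) ?addrK//.
  by move=> B; rewrite finset.properEneq andbC.
apply: cvgB; first exact: poisson_generating_function.
apply: cvg_big => [|B BA]; first exact: add_continuous.
apply: IH.
exact: leq_trans (proper_card BA) AN.
Qed.

Lemma sum_refresh_kernel (R : realType) (S : finType) (m : S -> R) (lam : R)
    (n : nat) (x y : S ^ n) :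
  \sum_(A : {set 'I_n}) (\prod_i (if i \in A then 1 - lam else lam))
     * refresh_kernel m A x y = noise_kernel m lam x y.
Proof.
rewrite /noise_kernel /lazy_kernel; under [RHS]eq_bigr do rewrite addrC.
rewrite bigA_distr; apply: eq_big => // A _; rewrite -big_split/=.
by apply: eq_bigr => i _; case: ifP.
Qed.

Lemma poisson_chain_kernel (R : realType) (S : finType) (m : S -> R) (n : nat)
    (t : R) (x y : S ^ n) :
  \sum_v m v = 1 -> (0 < n)%N -> 0 < t ->
  (fun K => \sum_(0 <= k < K) poisson_pmf t k * chain_kernel m k x y) @ \oo -->
  noise_kernel m (expR (- (t / n%:R))) x y.
Proof.
move=> m1 n0 t0; rewrite -sum_refresh_kernel.
have -> : (fun K => \sum_(0 <= k < K) poisson_pmf t k * chain_kernel m k x y) =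
  (fun K => \sum_(A : {set 'I_n})
    (\sum_(0 <= k < K) poisson_pmf t k * touched_law R k A) * refresh_kernel m A x y).
  apply/funext => K; under [RHS]eq_bigr do rewrite mulr_suml.
  rewrite exchange_big/=; apply: eq_bigr => k _.
  by rewrite chain_kernelE// mulr_sumr; apply: eq_bigr => A _; rewrite mulrA.
apply: cvg_big => [|A _]; first exact: add_continuous.
by apply: cvgM (cvg_cst _); exact: poisson_touched_law.
Qed.

(** * The law of the walk at two times *)

Section FiniteValued.
Context {d : measure_display} {T : measurableType d} {R : realType}.
Variable P : probability T R.

Lemma discrete_rv_preimage (S : finType) (Y : T -> S) (B : set S) :
  discrete_rv Y -> measurable (Y @^-1` B).
Proof.
move=> mY; have -> : Y @^-1` B = \bigcup_(s in B) (Y @^-1` [set s]).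
  by apply/seteqP; split => [w Bw|w [s Bs /= ->//]]; exists (Y w).
by apply: fin_bigcup_measurable => // s _; exact: mY.
Qed.

Lemma discrete_rv_comp (S : finType) (S' : Type) (Y : T -> S) (f : S -> S') :
  discrete_rv Y -> discrete_rv (f \o Y).
Proof. by move=> mY y; apply: (discrete_rv_preimage (f @^-1` [set y])). Qed.

Lemma discrete_rv_pair (S S' : Type) (Y : T -> S) (Z : T -> S') :
  discrete_rv Y -> discrete_rv Z -> discrete_rv (fun w => (Y w, Z w)).
Proof.
move=> mY mZ [y z].
have -> : (fun w => (Y w, Z w)) @^-1` [set (y, z)] =
  Y @^-1` [set y] `&` Z @^-1` [set z].
  by apply/seteqP; split => w /= [<- <-].
by apply: measurableI; [exact: mY|exact: mZ].
Qed.

Lemma probability_partition (S : finType) (Y : T -> S) (E : set T) :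
  discrete_rv Y -> measurable E ->
  P E = (\sum_s P (E `&` Y @^-1` [set s]))%E.
Proof.
move=> mY mE.
have {1}-> : E = \bigcup_(s in [set` index_enum S]) (E `&` Y @^-1` [set s]).
  apply/seteqP; split => [w Ew|w [s _ []//]].
  by exists (Y w) => //=; rewrite mem_index_enum.
rewrite measure_fin_bigcup//.
- by rewrite -fsbig_seq ?index_enum_uniq.
- by move=> s s' _ _ [w [[_ /= <-] [_ /= <-]]].
- by move=> s _; apply: measurableI => //; exact: mY.
Qed.

End FiniteValued.

Section PathLaw.
Context {d : measure_display} {T : measurableType d} {R : realType}.
Variable P : probability T R.
Context {Omega : finType} {n : nat}.
Variables (mu : Omega -> R) (N : R -> T -> nat) (X0 : T -> Omega ^ n).
Variables (I : nat -> T -> 'I_n) (V : nat -> T -> Omega).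
Hypothesis clockN : poisson_clock P N.
Hypothesis mX0 : discrete_rv X0.
Hypothesis mI : forall k, discrete_rv (I k).
Hypothesis mV : forall k, discrete_rv (V k).
Hypothesis lawI : forall k i, P [set w | I k w = i] = (n%:R^-1)%:E.
Hypothesis lawV : forall k v, P [set w | V k w = v] = (mu v)%:E.
Hypothesis lawX0 : forall x, P [set w | X0 w = x] = (\prod_i mu (x i))%:E.
Hypothesis indep : mutually_independent P (source_events N X0 I V).

(** An enumeration of the independent sources in which the first [2 K + 2]
    entries are the start, the clock and the first [K] selections and values;
    [source_index] is its inverse. *)
Definition source_of (j : nat) : source :=
  match j with
  | 0 => Start
  | 1 => Clock
  | j'.+2 => if odd j' then Fresh j'./2 else Coord j'./2
  end.

Definition source_index (s : source) : nat :=
  match s with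
  | Start => 0
  | Clock => 1
  | Coord k => k.*2.+2
  | Fresh k => k.*2.+3
  end.

Lemma source_ofK : cancel source_of source_index.
Proof.
case=> [|[|j]] //=; have := odd_double_half j.
by case: (odd j); rewrite ?add0n ?add1n /= => ->.
Qed.

Lemma source_indexK : cancel source_index source_of.
Proof.
case=> [||k|k] //=; first by rewrite odd_double doubleK.
by rewrite odd_double/= uphalf_double.
Qed.

Section JointLaw.
Variables (t : R) (x : Omega ^ n) (r : nat) (iota : nat -> 'I_n).
Variable nu : nat -> Omega.
Hypothesis t_gt0 : 0 < t.

Definition source_event (s : source) : set T :=
  match s with
  | Start => [set w | X0 w = x]
  | Clock => [set w | N t w = r]
  | Coord k => [set w | I k w = iota k]
  | Fresh k => [set w | V k w = nu k]
  end.

Definition source_mass (s : source) : R :=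
  match s with
  | Start => \prod_i mu (x i)
  | Clock => poisson_pmf t r
  | Coord k => n%:R^-1
  | Fresh k => mu (nu k)
  end.

Lemma source_eventP s : source_events N X0 I V s (source_event s).
Proof.
case: s => [||k|k] /=; rewrite ?/events_of/=.
- by exists [set x].
- apply: sub_sigma_algebra; exists t; rewrite /= ?ltW//.
  by exists [set r].
- by exists [set iota k].
- by exists [set nu k].
Qed.

Lemma source_event_mass s : P (source_event s) = (source_mass s)%:E.
Proof.
case: s => [||k|k] //=.
rewrite -[t in RHS]subr0 -(clock_increment clockN r (lexx 0) t_gt0).
by congr (P _); apply/seteqP; split => w /=; rewrite (clock0 clockN) subn0.
Qed.

Lemma joint_law K :
  P [set w | [/\ X0 w = x, N t w = r &
      forall j, (j < K)%N -> I j w = iota j /\ V j w = nu j]] =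
  ((\prod_i mu (x i)) * poisson_pmf t r
    * \prod_(0 <= j < K) (n%:R^-1 * mu (nu j)))%:E.
Proof.
have inj : injective (fun i : 'I_K.*2.+2 => source_of i).
  by move=> i j /(can_inj source_ofK)/val_inj.
have := indep (E := fun i => source_event (source_of i)) inj
  (fun i => source_eventP _).
have -> : \bigcap_(i : 'I_K.*2.+2) source_event (source_of i) =
  [set w | [/\ X0 w = x, N t w = r &
      forall j, (j < K)%N -> I j w = iota j /\ V j w = nu j]].
  apply/seteqP; split => w /= h.
    have hs s : (source_index s < K.*2.+2)%N -> source_event s w.
      move=> sK; have := h (Ordinal sK) Logic.I.
      by rewrite (_ : source_of _ = s) ?source_indexK.
    split; [exact: (hs Start)|exact: (hs Clock)|].
    move=> j jK; split; first by apply: (hs (Coord j)); rewrite /= !ltnS ltn_double.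
    by apply: (hs (Fresh j)); rewrite /= !ltnS ltn_Sdouble.
  move=> [[|[|i]] iK] _ //=; first by case: h.
    by case: h.
  have [_ _ h'] := h.
  have iK2 : (i./2 < K)%N by rewrite ltn_half_double.
  by have [hI hV] := h' _ iK2; case: ifP.
move=> ->; rewrite (eq_bigr (fun i : 'I_K.*2.+2 => (source_mass (source_of i))%:E)).
  2: by move=> i _; exact: source_event_mass.
rewrite prodEFin; congr (_%:E).
rewrite 2!big_ord_recl /= mulrA; congr (_ * _).
rewrite -(big_mkord predT (fun i => source_mass (source_of i.+2))).
elim: K {inj} => [|K IH]; first by rewrite !big_geq.
rewrite doubleS !big_nat_recr//= IH odd_double /= uphalf_double.
by rewrite mulrA.
Qed.

End JointLaw.

Lemma jump_chain_discrete_rv k : discrete_rv (jump_chain X0 I V k).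
Proof.
elim: k => [|k IH] //=.
have mp := discrete_rv_pair (discrete_rv_pair IH (mI k)) (mV k).
exact: (discrete_rv_comp (fun p => resample p.1.1 p.1.2 p.2) mp).
Qed.

(** The rings [k], ..., [K - 1], not yet used by the chain, are prescribed as
    well, so that an event for [k + 1] splits into events for [k]. *)
Definition path_event (t : R) (x : Omega ^ n) (r K k : nat) (y : Omega ^ n)
    (iota : nat -> 'I_n) (nu : nat -> Omega) : set T :=
  [set w | [/\ X0 w = x, N t w = r, jump_chain X0 I V k w = y
    & forall j, (k <= j < K)%N -> I j w = iota j /\ V j w = nu j]].

Lemma measurable_path_event t x r K k y iota nu : 0 < t ->
  measurable (path_event t x r K k y iota nu).
Proof.
move=> t0; have -> : path_event t x r K k y iota nu =
  X0 @^-1` [set x] `&` N t @^-1` [set r]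
  `&` jump_chain X0 I V k @^-1` [set y]
  `&` \bigcap_(j in [set j | (k <= j < K)%N])
       (I j @^-1` [set iota j] `&` V j @^-1` [set nu j]).
  apply/seteqP; split => w /= [].
    by move=> a b c e; split=> // j /e [].
  by move=> [[a b] c] e; split => // j /e [].
apply: measurableI; [apply: measurableI; [apply: measurableI|]|].
- exact: mX0.
- by have := clock_rv clockN (ltW t0); apply.
- exact: jump_chain_discrete_rv.
- apply: bigcap_measurableType => j _.
  by apply: measurableI; [exact: mI|exact: mV].
Qed.

(** By induction on [k], conditioning on the state before the last ring and on
    what this ring does: the event for [k + 1] is a disjoint union of events for
    [k], in which one more ring is prescribed. In this way independence is used
    only for rectangles in the sources, at [k = 0]. *)
Lemma path_law t x r K k y iota nu : 0 < t -> (k <= K)%N ->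
  P (path_event t x r K k y iota nu) =
  ((\prod_i mu (x i)) * poisson_pmf t r * chain_kernel mu k x y
    * \prod_(k <= j < K) (n%:R^-1 * mu (nu j)))%:E.
Proof.
move=> t0; elim: k y iota nu => [|k IH] y iota nu kK /=.
  have [<-|xy] := eqVneq x y.
    rewrite mulr1 -(joint_law x r iota nu t0 K); congr (P _).
    apply/seteqP; split => w /= [].
      by move=> a b _ c; split => // j jK; apply: c.
    by move=> a b c; split => // j jK; apply: c.
  rewrite mulr0 mul0r (_ : path_event _ _ _ _ _ _ _ _ = set0) ?measure0//.
  by apply/seteqP; split => w //= -[a _ b _]; move: xy; rewrite -a -b eqxx.
have mp := discrete_rv_pair (discrete_rv_pair (jump_chain_discrete_rv k) (mI k)) (mV k).
rewrite (probability_partition _ mp (measurable_path_event _ _ _ _ _ _ _ t0)).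
set c := (\prod_i mu (x i)) * poisson_pmf t r.
set e := \prod_(k.+1 <= j < K) _.
rewrite (eq_bigr (fun s : Omega ^ n * 'I_n * Omega =>
  (c * (chain_kernel mu k x s.1.1 * (n%:R^-1 * mu s.2)
    * (resample s.1.1 s.1.2 s.2 == y)%:R) * e)%:E)); last first.
  move=> [[z i] v] _ /=.
  have [ry|ry] := eqVneq (resample z i v) y; last first.
    rewrite !mulr0 mul0r (_ : _ `&` _ = set0) ?measure0//.
    apply/seteqP; split => w //= -[[_ _ a _] [b b' b'']].
    by move: ry; rewrite -a -b -b' -b'' eqxx.
  pose iota' j := if j == k then i else iota j.
  pose nu' j := if j == k then v else nu j.
  have -> : path_event t x r K k.+1 y iota nu `&`
      (fun w => (jump_chain X0 I V k w, I k w, V k w)) @^-1` [set (z, i, v)] =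
      path_event t x r K k z iota' nu'.
    apply/seteqP; split => w /=.
      move=> [[a b _ h] [hz hi hv]]; split => // j /andP[kj jK].
      rewrite /iota' /nu'; have [->|jk] := eqVneq j k; first by split.
      by apply: h; rewrite jK ltn_neqAle eq_sym jk kj.
    move=> [a b hz h].
    have [hi hv] : I k w = i /\ V k w = v.
      by have := h k; rewrite leqnn kK /iota' /nu' eqxx => /(_ isT).
    split; last by rewrite hz hi hv.
    split => //; first by rewrite /= hz hi hv.
    move=> j /andP[kj jK]; have := h j; rewrite (ltnW kj) jK => /(_ isT).
    by rewrite /iota' /nu' gtn_eqF.
  rewrite IH ?(ltnW kK)//; congr (_%:E).
  rewrite big_ltn// {1}/nu' eqxx (eq_big_nat _ _ (F2 := fun j => n%:R^-1 * mu (nu j))).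
    by rewrite -/e -/c mulr1; ring.
  by move=> j /andP[kj _]; rewrite /nu' gtn_eqF.
rewrite sumEFin; congr (_%:E); rewrite -mulr_suml -mulr_sumr; congr (_ * _ * _).
rewrite -(pair_bigA _ (fun p v => chain_kernel mu k x p.1 * (n%:R^-1 * mu v)
    * (resample p.1 p.2 v == y)%:R))/=.
by rewrite -(pair_bigA _ (fun z i => \sum_v chain_kernel mu k x z * (n%:R^-1 * mu v)
    * (resample z i v == y)%:R)).
Qed.

Lemma walk_at_ring_law t x r y : 0 < t -> (0 < n)%N ->
  P [set w | [/\ X0 w = x, N t w = r & jump_chain X0 I V r w = y]] =
  ((\prod_i mu (x i)) * poisson_pmf t r * chain_kernel mu r x y)%:E.
Proof.
move=> t0 n0.
have := path_law x r y (fun=> Ordinal n0) (fun=> x (Ordinal n0)) t0 (leqnn r).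
rewrite big_geq// mulr1 => <-; congr (P _); apply/seteqP; split => w /= [].
  by move=> a b c; split => // j; rewrite ltnNge andbN.
by [].
Qed.

Definition ring_event t r (A B : {set Omega ^ n}) : set T :=
  [set w | [/\ X0 w \in A, N t w = r & jump_chain X0 I V r w \in B]].

Lemma measurable_ring_event t r (A B : {set Omega ^ n}) : 0 < t ->
  measurable (ring_event t r A B).
Proof.
move=> t0; rewrite (_ : ring_event t r A B = N t @^-1` [set r] `&`
    (fun w => (X0 w, jump_chain X0 I V r w)) @^-1`
      [set p | p.1 \in A /\ p.2 \in B]).
  apply: measurableI; first by have := clock_rv clockN (ltW t0); apply.
  apply: discrete_rv_preimage.
  exact: discrete_rv_pair mX0 (jump_chain_discrete_rv r).
by apply/seteqP; split => w /= [] => [a b c|a [b c]].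
Qed.

Lemma walk_at_ring_sets t r (A B : {set Omega ^ n}) : 0 < t -> (0 < n)%N ->
  P (ring_event t r A B) =
  (\sum_(x in A) \sum_(y in B)
    (\prod_i mu (x i)) * poisson_pmf t r * chain_kernel mu r x y)%:E.
Proof.
move=> t0 n0.
have mp := discrete_rv_pair mX0 (jump_chain_discrete_rv r).
rewrite (probability_partition _ mp (measurable_ring_event r A B t0)).
rewrite pair_big_dep/=.
rewrite [in RHS]big_mkcond/= -sumEFin; apply: eq_bigr => -[x y] _ /=.
case: ifPn => [/andP[xA yB]|xyAB]; last first.
  rewrite (_ : _ `&` _ = set0) ?measure0//.
  apply/seteqP; split => w //= -[[a _ b] [c e]].
  by move: xyAB; rewrite -c -e a b.
rewrite -walk_at_ring_law//; congr (P _); apply/seteqP; split => w /=.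
  by move=> [[_ a _] [b c]].
by move=> [a b c]; split; [split; rewrite ?a ?c|rewrite a c].
Qed.

(** Summing over the number [r < K] of rings gives a lower bound for every [K];
    the partial sums converge by [poisson_chain_kernel]. *)
Lemma walk_two_time_lower_bound t (A B : {set Omega ^ n}) :
  \sum_v mu v = 1 -> 0 < t -> (0 < n)%N ->
  ((\sum_(x in A) \sum_(y in B)
     (\prod_i mu (x i)) * noise_kernel mu (expR (- (t / n%:R))) x y)%:E
   <= P [set w | X0 w \in A /\ jump_chain X0 I V (N t w) w \in B])%E.
Proof.
move=> mu1 t0 n0; set E := [set w | _].
pose E' r := ring_event t r A B.
have mE' r : measurable (E' r) by exact: measurable_ring_event.
have EE : E = \bigcup_r E' r.
  apply/seteqP; split => w /=; first by move=> [a b]; exists (N t w).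
  by move=> [r _ [a <- b]].
have mE : measurable E by rewrite EE; apply: bigcupT_measurable.
have [p pE] : exists p, P E = p%:E.
  by exists (fine (P E)); rewrite fineK// fin_num_measure.
pose s K := \sum_(0 <= r < K) \sum_(x in A) \sum_(y in B)
  (\prod_i mu (x i)) * poisson_pmf t r * chain_kernel mu r x y.
have sp K : s K <= p.
  rewrite -lee_fin -pE /s -sumEFin big_mkord.
  under eq_bigr do rewrite -walk_at_ring_sets//.
  rewrite -(measure_bigsetU_ord P xpredT (fun r => mE' (val r)))//; last first.
    by move=> i j _ _ [w [[_ iw _] [_ jw _]]]; apply/val_inj/(etrans (esym iw) jw).
  apply: le_measure; rewrite ?inE//.
    by apply: bigsetU_measurable.
  rewrite EE; apply: (@subset_trans _ (\bigcup_(i in [set` index_enum 'I_K]) E' i)).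
    by rewrite bigcup_seq.
  by move=> w [i _ Ei]; exists i.
rewrite pE lee_fin.
have s_cvg : s @ \oo --> \sum_(x in A) \sum_(y in B)
     (\prod_i mu (x i)) * noise_kernel mu (expR (- (t / n%:R))) x y.
  rewrite (_ : s = fun K => \sum_(x in A) \sum_(y in B) (\prod_i mu (x i))
      * (\sum_(0 <= r < K) poisson_pmf t r * chain_kernel mu r x y)).
    apply: cvg_big => [|x _]; first exact: add_continuous.
    apply: cvg_big => [|y _]; first exact: add_continuous.
    by apply: cvgM; [exact: cvg_cst|exact: poisson_chain_kernel].
  apply/funext => K; rewrite /s exchange_big/=; apply: eq_bigr => x _.
  rewrite exchange_big/=; apply: eq_bigr => y _; rewrite mulr_sumr.
  by apply: eq_bigr => r _; rewrite mulrA.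
rewrite -(cvg_lim _ s_cvg)//; apply: limr_le; first exact: cvgP s_cvg.
by near=> K; exact: sp.
Unshelve. all: by end_near.
Qed.

End PathLaw.

Theorem proposition9p2 (R : realType) (Omega : finType) (mu : Omega -> R)
  (mu_gt0 : forall v, 0 < mu v) (mu_sum1 : \sum_v mu v = 1)
  (n : nat) (n_ge1 : (1 <= n)%N)
  (d : measure_display) (T : measurableType d) (P : probability T R)
  (X : R -> T -> Omega ^ n) (walkX : hypercube_walk P mu X)
  (X0_law : forall A : {set Omega ^ n},
     P [set w | X 0 w \in A] = (product_mass mu A)%:E)
  (a b tau : R) (a_ge0 : 0 <= a) (b_ge0 : 0 <= b) (tau_gt0 : 0 < tau)
  (A B : {set Omega ^ n})
  (massA : product_mass mu A = expR (- (a ^+ 2 / 2)))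
  (massB : product_mass mu B = expR (- (b ^+ 2 / 2)))
  (t : R) (t_ge : tau * n%:R <= t) :
  let bound :=
    expR (- (((2 - expR (- tau)) * (a ^+ 2 + b ^+ 2)
              + 2 * expR (- (tau / 2)) * a * b)
             / (4 * (1 - expR (- tau))))) in
  (bound%:E <= P [set w | X 0%R w \in A /\ X t w \in B])%E /\
  expR (- ((a ^+ 2 + b ^+ 2 - a * b) / 4))
    * expR (- ((a + b) ^+ 2 / (4 * (1 - expR (- tau))))) <= bound.
Proof.
have mu0 v : 0 <= mu v by exact: ltW.
have n0 : 0 < n%:R :> R by rewrite ltr0n.
have t0 : 0 < t by apply: lt_le_trans t_ge; rewrite mulr_gt0.
move=> bound; set q := expR (- (tau / 2)).
have q0 : 0 < q by exact: expR_gt0.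
have q1 : q < 1 by rewrite expR_lt1 oppr_lt0 divr_gt0.
have q2 : expR (- tau) = q ^+ 2 by rewrite -expRM_natl; congr expR; field.
have d0 : 0 < 1 - q ^+ 2 by rewrite subr_gt0 expr_lt1// ltW.
have boundE : bound = expR (- noise_exponent q a b).
  rewrite /bound /noise_exponent q2 -/q; congr (expR (- _)).
  by field; rewrite gt_eqF.
split; last first.
  rewrite boundE -expRD ler_expR q2 -subr_ge0.
  have -> : - noise_exponent q a b - (- ((a ^+ 2 + b ^+ 2 - a * b) / 4)
      - (a + b) ^+ 2 / (4 * (1 - q ^+ 2))) = a * b * (1 - q) / (4 * (1 + q)).
    rewrite /noise_exponent; field.
    by rewrite !gt_eqF ?subr_gt0//; lra.
  by rewrite divr_ge0 ?mulr_ge0//; lra.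
have [N [I [V [[clockN mX0 mI mV] lawI lawV indep XE]]]] := walkX.
have lawX0 x : P [set w | X 0 w = x] = (\prod_i mu (x i))%:E.
  have <- : product_mass mu [set x]%SET = \prod_i mu (x i).
    by rewrite /product_mass big_set1.
  rewrite -X0_law; congr (P _); apply/seteqP; split => w /=; rewrite finset.inE.
    by move=> ->.
  by move/eqP.
have -> : [set w | X 0 w \in A /\ X t w \in B] =
    [set w | X 0 w \in A /\ jump_chain (X 0) I V (N t w) w \in B].
  by apply/seteqP; split => w /=; rewrite (XE t w (ltW t0)).
apply: le_trans (walk_two_time_lower_bound clockN mX0 mI mV lawI lawV lawX0
  indep A B mu_sum1 t0 n_ge1).
rewrite lee_fin boundE; set rho := expR (- (t / n%:R / 2)).
have rho2 : expR (- (t / n%:R)) = rho ^+ 2.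
  by rewrite -expRM_natl; congr expR; field; rewrite gt_eqF.
have rhoq : rho <= q by rewrite ler_expR lerN2 ler_pM2r// ler_pdivlMr.
have rho0 : 0 < rho by exact: expR_gt0.
rewrite rho2; apply: le_trans (noise_set_lower_bound_exponent mu0 mu_sum1 _
  a_ge0 b_ge0 massA massB); last by rewrite rho0 (le_lt_trans rhoq).
by rewrite ler_expR lerN2 noise_exponent_le// rhoq ltW.
Qed.
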